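(* Let $f:[\theta_1,\theta_2]\to\mathbb{R}$ be a differentiable function on $(\theta_1,\theta_2)$ with $\theta_1<\theta_2$ and $f'\in L_1[\theta_1,\theta_2]$. If $|f'|^q$ is a convex function, then the following inequality for Atangana-Baleanu fractional integral operators holds: $$\Bigg|\frac{2(\theta_2-\theta_1)^{\alpha}+(1-\alpha)2^{\alpha+1}\Gamma(\alpha)}{(\theta_2-\theta_1)^{\alpha+1}}\left[f(\theta_1)+f(\theta_2)+2f\left(\tfrac{\theta_1+\theta_2}{2}\right)\right]$$ $$-\frac{2^{\alpha+1}B(\alpha)\Gamma(\alpha)}{(\theta_2-\theta_1)^{\alpha+1}}\left[\left({}^{AB}I^{\alpha}_{\frac{\theta_1+\theta_2}{2}}f\right)(\theta_1)+\left({}^{AB}_{\theta_1}I^{\alpha}f\right)\left(\tfrac{\theta_1+\theta_2}{2}\right)+\left({}^{AB}_{\frac{\theta_1+\theta_2}{2}}I^{\alpha}f\right)(\theta_2)+\left({}^{AB}I^{\alpha}_{\theta_2}f\right)\left(\tfrac{\theta_1+\theta_2}{2}\right)\right]\Bigg|$$ $$\le\frac{4}{p(\alpha p+1)}+\frac{2\left[|f'(\theta_1)|^q+|f'(\theta_2)|^q\right]}{q},$$ where $p^{-1}+q^{-1}=1$, $\alpha\in[0,1]$, $q>1$ and $B(\alpha)$ is a normalization function.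
   Context: $\Gamma$ is the Gamma function and $B(\alpha)$ is the normalization function appearing in the Atangana-Baleanu operators. The left and right Atangana-Baleanu fractional integrals of order $\alpha\in[0,1]$ with base points $a$ and $b$ are, respectively, $$\left({}^{AB}_{a}I^{\alpha}f\right)(t)=\frac{1-\alpha}{B(\alpha)}f(t)+\frac{\alpha}{B(\alpha)\Gamma(\alpha)}\int_a^t f(y)(t-y)^{\alpha-1}\,dy,$$ $$\left({}^{AB}I^{\alpha}_{b}f\right)(t)=\frac{1-\alpha}{B(\alpha)}f(t)+\frac{\alpha}{B(\alpha)\Gamma(\alpha)}\int_t^b f(y)(y-t)^{\alpha-1}\,dy.$$
   Formalization: The case α = 0 is excluded because Γ(0) is undefined there, and f is assumed to have finite one-sided derivatives at θ₁ and θ₂, which are the values f'(θ₁), f'(θ₂); without this, f could jump at an endpoint and the inequality would fail. *)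

(* Defs.v *)
From mathcomp Require Import all_boot all_order all_algebra.
From mathcomp Require Import all_classical all_reals all_analysis.

Set Implicit Arguments.
Unset Strict Implicit.
Unset Printing Implicit Defensive.

Import Order.TTheory GRing.Theory Num.Theory.
Import numFieldNormedType.Exports.

Local Open Scope classical_set_scope.
Local Open Scope ring_scope.

(* Euler's integral; it converges exactly for x > 0, and the value produced by
   [Rintegral] is meaningful only there. *)
Definition Gamma_fun (R : realType) (x : R) : R :=
  \int[lebesgue_measure]_(t in `]0, +oo[) (t `^ (x - 1) * expR (- t)).

(* [AB_left B a alpha f t] has base point a <= t; [AB_right B b alpha f t] has
   base point b >= t.  At the singular endpoint y = t the kernel takes the
   conventional value of [powR] at base 0, on a null set. *)
Definition AB_left (R : realType) (B : R -> R) (a alpha : R) (f : R -> R)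
    (t : R) : R :=
  (1 - alpha) / B alpha * f t
  + alpha / (B alpha * Gamma_fun alpha)
    * \int[lebesgue_measure]_(y in `[a, t]) (f y * (t - y) `^ (alpha - 1)).

Definition AB_right (R : realType) (B : R -> R) (b alpha : R) (f : R -> R)
    (t : R) : R :=
  (1 - alpha) / B alpha * f t
  + alpha / (B alpha * Gamma_fun alpha)
    * \int[lebesgue_measure]_(y in `[t, b]) (f y * (y - t) `^ (alpha - 1)).

Definition is_right_derivative (R : realType) (f : R -> R) (x l : R) : Prop :=
  (f y - f x) / (y - x) @[y --> x^'+] --> l.

Definition is_left_derivative (R : realType) (f : R -> R) (x l : R) : Prop :=
  (f y - f x) / (y - x) @[y --> x^'-] --> l.

(* [df] is the derivative of the restriction of f to [a, b]: two-sided inside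
   and one-sided at a and b; values of f outside [a, b] are irrelevant. *)
Definition is_derivative_on (R : realType) (a b : R) (f df : R -> R) : Prop :=
  [/\ {in `]a, b[, forall x, is_derive x (1 : R) f (df x)},
      is_right_derivative f a (df a) &
      is_left_derivative f b (df b)].

(* Main.v *)
Require Import Defs.
From mathcomp Require Import all_boot all_order all_algebra.
From mathcomp Require Import all_classical all_reals all_analysis.
From mathcomp Require Import measurable_realfun ring lra.

(** Write a, b for the endpoints, m for the midpoint and h = (b - a) / 2.
Because Gamma(alpha) is nonzero, the local terms and the normalizations of the
four Atangana-Baleanu integrals combine with the first bracket, and the quantity
to bound becomes h^-(alpha+1) times a sum of four differences

    h^alpha f(endpoint) - alpha * (integral of f against a power kernel)

two on [a, m] and two on [m, b], the kernel being |y - z|^(alpha-1) with z one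
end of the half interval and the endpoint being the other one.  By parts, each
difference is, up to sign, the integral of f' against |y - z|^alpha.  With
s = |y - z| / h in [0, 1], Young's inequality gives

    s^alpha |f'| <= s^(alpha p) / p + |f'|^q / q,

and |f'|^q lies below its chord by convexity.  Integrating, the powers of s give
1 / (p (alpha p + 1)) for each of the four terms, and the chord, counted twice on
each half of [a, b], gives 2 (|f'(a)|^q + |f'(b)|^q) / q.

The derivative f' may be discontinuous, so the integration by parts is never
written as an identity between integrals.  If K is the primitive of the kernel k,
the function x |-> K(x) f(x) - int_c^x f k has derivative K f' at every interior
point: the factor f' comes from the product rule, and only the continuous
integrand f k goes through the fundamental theorem of calculus.  Since the bound
on |K f'| above has an explicit primitive Phi, monotonicity of Phi plus or minus
this function bounds its increment ([norm_increment_le], [by_parts_bound],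
[power_kernel_bound]).

Two integrability facts remain, for the singular kernels and for Gamma; both follow
from [integrable_ge0_derivative]. *)

Import Order.TTheory GRing.Theory Num.Theory.
Import numFieldNormedType.Exports.

Local Open Scope classical_set_scope.
Local Open Scope ring_scope.

Set Implicit Arguments.
Unset Strict Implicit.
Unset Printing Implicit Defensive.

(** * Derivatives of real functions *)

Lemma is_derive_continuous (R : realType) (f : R -> R) (x l : R) :
  is_derive x 1 f l -> {for x, continuous f}.
Proof. by case=> df _; exact/differentiable_continuous/derivable1_diffP. Qed.

Lemma is_derive_chain (R : realType) (f g : R -> R) (x df dg : R) :
  is_derive (g x) 1 f df -> is_derive x 1 g dg ->
  is_derive x 1 (fun y => f (g y)) (df * dg).
Proof.
move=> [f1 <-] [g1 <-]; split.
  have /derivable1_diffP dgx := g1; have /derivable1_diffP dfgx := f1.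
  have /derivable1_diffP := differentiable_comp dgx dfgx; exact.
by rewrite -derive1E (derive1_comp g1 f1) !derive1E.
Qed.

(** * Integrability of nonnegative derivatives *)

(** On each [[u n, v n]] the fundamental theorem of calculus evaluates the integral
as an increment of [K], hence at most [M]; monotone convergence carries the bound
over to the union.  The exhaustion lets [k] blow up at the ends of [D]. *)
Lemma integrable_ge0_derivative (R : realType) (K k : R -> R) (D : set R)
    (u v : R^nat) (M : R) :
  nonincreasing_seq u -> nondecreasing_seq v ->
  D = \bigcup_n `[u n, v n]%classic ->
  (forall x, D x -> is_derive x 1 K (k x)) ->
  (forall x, D x -> {for x, continuous k}) ->
  (forall x, D x -> 0 <= k x) ->
  0 <= M -> (forall n, u n < v n -> K (v n) - K (u n) <= M) ->
  lebesgue_measure.-integrable D (EFin \o k).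
Proof.
move=> ni_u nd_v DE dK ck k0 M0 KM.
have sub n : `[u n, v n] `<=` D by rewrite DE => x xn; exists n.
have mD : measurable D by rewrite DE; exact: bigcup_measurable.
have cA (A : set R) : A `<=` D -> {within A, continuous k}.
  by move=> AD; apply: continuous_in_subspaceT => x /set_mem /AD /ck.
have mk : measurable_fun D k.
  apply: subspace_continuous_measurable_fun => //.
  exact: cA.
apply/integrableP; split; first exact/measurable_EFinP.
under eq_integral => x /set_mem Dx do rewrite /= ger0_norm ?k0//.
have bnd n : (\int[lebesgue_measure]_(x in `[u n, v n]) (k x)%:E <= M%:E)%E.
  have [uv|vu] := ltP (u n) (v n); last first.
    rewrite (_ : (\int[_]_(_ in _) _ = 0)%E) ?lee_fin//.
    move: vu; rewrite le_eqVlt => /predU1P[->|vu].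
      by rewrite set_itv1 integral_set1.
    by rewrite set_itv_ge ?integral_set0// bnd_simp -ltNge.
  have uvK : {within `[u n, v n], continuous K}.
    apply: derivable_within_continuous => x /= xuv.
    by have [] := dK x (sub n x xuv).
  rewrite (@continuous_FTC2 _ k K _ _ uv) ?lee_fin ?KM//.
  - exact: cA (sub n).
  - have /(continuous_within_itvP _ uv)[_ ? ?] := uvK; split => // x xuv.
    by have [] := dK x (sub n x (subset_itv_oo_cc xuv)).
  - move=> x xuv; rewrite derive1E.
    by have [_ ->] := dK x (sub n x (subset_itv_oo_cc xuv)).
have cvgk : (\int[lebesgue_measure]_(x in `[u n, v n]) (k x)%:E @[n --> \oo]
    --> \int[lebesgue_measure]_(x in D) (k x)%:E)%E.
  rewrite DE; apply: ge0_nondecreasing_set_cvg_integral => //.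
  - move=> m n mn; rewrite subsetEset; apply: subset_itv; rewrite bnd_simp.
      exact: ni_u.
    exact: nd_v.
  - move=> n; apply/measurable_EFinP; exact: measurable_funS (sub n) mk.
  - by move=> n x uvx; rewrite lee_fin k0//; exact: (sub n).
rewrite (@le_lt_trans _ _ M%:E) ?ltry//.
move/cvg_lim: (cvgk) => <- //; apply: lime_le.
  by apply/cvg_ex; eexists; exact: cvgk.
exact: nearW.
Qed.

Lemma itvoo_bigcup (R : realType) (c d : R) :
  `]c, d[%classic = \bigcup_n `[c + n.+1%:R^-1, d - n.+1%:R^-1]%classic.
Proof.
apply/seteqP; split => [x /=|x [n _] /=]; rewrite !in_itv/=; last first.
  have : 0 < n.+1%:R^-1 :> R by rewrite invr_gt0 ltr0n.
  by move: (n.+1%:R^-1) => e e0 /andP[? ?]; apply/andP; split; lra.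
move=> /andP[/ltr_add_invr[m cx] /ltr_add_invr[n xd]].
exists (maxn m n) => //=; rewrite in_itv/=.
have le_inv (i : nat) : (i <= maxn m n)%N -> (maxn m n).+1%:R^-1 <= i.+1%:R^-1 :> R.
  by move=> ?; rewrite lef_pV2 ?posrE ?ltr0n// ler_nat.
have := le_inv m (leq_maxl _ _); have := le_inv n (leq_maxr _ _).
move: (_^-1) (_^-1) (_^-1) cx xd => r s t cx xd rs ts.
by apply/andP; split; lra.
Qed.

Lemma itvoy_bigcup (R : realType) :
  `]0, +oo[%classic = \bigcup_n `[n.+1%:R^-1 : R, n.+1%:R]%classic.
Proof.
apply/seteqP; split => [x /=|x [n _] /=]; rewrite !in_itv/= ?andbT; last first.
  by case/andP=> + _; apply: lt_le_trans; rewrite invr_gt0 ltr0n.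
move=> x0; have /ltr_add_invr[m] := x0; rewrite add0r => mx.
pose n := Num.truncn x.
have xn : x < n.+1%:R by rewrite truncnS_gt.
exists (maxn m n) => //=; rewrite in_itv/=; apply/andP; split.
  apply: le_trans (ltW mx); rewrite lef_pV2 ?posrE ?ltr0n// ler_nat ltnS.
  exact: leq_maxl.
by apply: le_trans (ltW xn) _; rewrite ler_nat ltnS leq_maxr.
Qed.

(** * Positivity of the Gamma function on (0, 1] *)

(** As 1 - exp(-t) <= t and x - 1 <= 0, the integrand is at most
(1 - exp(-t))^(x-1) exp(-t), the derivative of (1 - exp(-t))^x / x.  That primitive
stays between 0 and 1/x, so the singularity at 0 and the tail at infinity are
controlled at once. *)
Lemma Gamma_integrable (R : realType) (x : R) : 0 < x <= 1 ->
  lebesgue_measure.-integrable `]0, +oo[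
    (EFin \o (fun t : R => t `^ (x - 1) * expR (- t))).
Proof.
move=> /andP[x0 x1].
pose s (t : R) : R := 1 - expR (- t).
have s_gt0 (t : R) : 0 < t -> 0 < s t.
  by move=> t0; rewrite subr_gt0 -expR0 ltr_expR oppr_lt0.
have de (t : R) : is_derive t 1 (fun t => expR (- t)) (- expR (- t)).
  have := is_derive_chain (is_derive_expR (- t)) (is_deriveNid t 1).
  by rewrite mulrN1.
have ds (t : R) : is_derive t 1 s (expR (- t)).
  rewrite -[expR (- t)]opprK -[X in is_derive _ _ _ X]add0r.
  exact: is_deriveB (is_derive_cst _ _ _) (de t).
pose k (t : R) : R := s t `^ (x - 1) * expR (- t).
have dK (t : R) : 0 < t -> is_derive t 1 (fun t => x^-1 * s t `^ x) (k t).
  move=> t0; have dc := is_derive_chain (is_derive1_powR x (s_gt0 t t0)) (ds t).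
  have -> : k t = x^-1 *: (x * s t `^ (x - 1) * expR (- t)).
    by rewrite /GRing.scale/= !mulrA mulVf ?gt_eqF// mul1r.
  exact: is_deriveZ.
have intk : lebesgue_measure.-integrable `]0, +oo[ (EFin \o k).
  apply: (@integrable_ge0_derivative _ (fun t => x^-1 * s t `^ x) k
    _ (fun n => n.+1%:R^-1) (fun n => n.+1%:R) x^-1).
  - by move=> m n mn; rewrite lef_pV2 ?posrE ?ltr0n// ler_nat.
  - by move=> m n mn; rewrite ler_nat.
  - exact: itvoy_bigcup.
  - by move=> t /=; rewrite in_itv/= andbT; exact: dK.
  - move=> t /=; rewrite in_itv/= andbT => t0.
    have dp := is_derive_chain (is_derive1_powR (x - 1) (s_gt0 t t0)) (ds t).
    exact: cvgM (is_derive_continuous dp) (is_derive_continuous (de t)).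
  - by move=> t _; rewrite mulr_ge0 ?powR_ge0 ?expR_ge0.
  - by rewrite invr_ge0 ltW.
  - move=> n _; apply: (@le_trans _ _ (x^-1 * s n.+1%:R `^ x)).
      by rewrite gerBl mulr_ge0 ?powR_ge0// invr_ge0 ltW.
    rewrite ler_piMr ?invr_ge0 ?(ltW x0)//.
    have : s n.+1%:R `^ x <= 1 `^ x; last by rewrite powR1.
    rewrite ge0_ler_powR ?nnegrE ?(ltW x0)//.
      by rewrite ltW// s_gt0// ltr0n.
    by rewrite gerBl expR_ge0.
apply: le_integrable intk => //.
  apply/measurable_EFinP; apply: measurable_funM.
    by apply: measurable_funTS; exact: measurable_powR.
  apply: measurable_funTS; apply: continuous_measurable_fun => t.
  exact: is_derive_continuous (de t).
move=> t /=; rewrite in_itv/= andbT => t0.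
rewrite lee_fin !ger0_norm ?mulr_ge0 ?powR_ge0 ?expR_ge0//.
rewrite ler_wpM2r ?expR_ge0// -opprB !powRN.
rewrite lef_pV2 ?posrE ?powR_gt0 ?s_gt0//.
rewrite ge0_ler_powR ?nnegrE ?subr_ge0 ?(ltW t0) ?(ltW (s_gt0 _ _))//.
  by rewrite -subr_ge0; exact/ltW/s_gt0.
by have := expR_ge1Dx (- t); rewrite /s; lra.
Qed.

(** [Gamma_fun] is the finite part of an extended real integral, hence would be 0 if
the integral diverged; [Gamma_integrable] excludes this.  The lower bound comes
from the interval [[1, 2]]. *)
Lemma Gamma_fun_gt0 (R : realType) (x : R) : 0 < x <= 1 -> 0 < Gamma_fun x.
Proof.
move=> x01; have intg := Gamma_integrable x01.
have /andP[x0 x1] := x01.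
set g := fun t : R => t `^ (x - 1) * expR (- t) in intg.
have g0 (t : R) : 0 <= g t by rewrite mulr_ge0 ?powR_ge0 ?expR_ge0.
have sub12 : `[1, 2]%classic `<=` (`]0, +oo[%classic : set R).
  by move=> t /=; rewrite !in_itv/= andbT => /andP[/(lt_le_trans ltr01)].
have int12 : lebesgue_measure.-integrable (`[1, 2] : set R) (EFin \o g).
  by apply: integrableS intg => //.
pose c : R := 2 `^ (x - 1) * expR (- 2).
have c0 : 0 < c by rewrite mulr_gt0 ?powR_gt0 ?expR_gt0.
apply: (@lt_le_trans _ _ (\int[lebesgue_measure]_(t in `[1, 2]) g t)).
  apply: (@lt_le_trans _ _ (\int[lebesgue_measure]_(t in `[1, 2]) c)).
    have mu12 : lebesgue_measure (`[1, 2]%classic : set R) = 1%:E.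
      by rewrite lebesgue_measure_itv/= lte_fin ltr1n -EFinB (_ : 2 - 1 = 1)//; lra.
    by rewrite Rintegral_cst// [X in fine X]mu12 mulr1.
  apply: le_Rintegral => //.
    apply: continuous_compact_integrable; first exact: segment_compact.
    by apply: continuous_subspaceT => t; exact: cvg_cst.
  move=> t /=; rewrite in_itv/= => /andP[t1 t2].
  have t0 : 0 < t := lt_le_trans ltr01 t1.
  apply: ler_pM; rewrite ?powR_ge0 ?expR_ge0//; last by rewrite ler_expR lerN2.
  rewrite -opprB !powRN lef_pV2 ?posrE ?powR_gt0//.
  by rewrite ge0_ler_powR ?nnegrE ?subr_ge0 ?(ltW t0).
rewrite /Gamma_fun /Rintegral fine_le ?integrable_fin_num//.
apply: ge0_subset_integral => //.
  by case/integrableP : intg.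
by move=> t _; rewrite lee_fin.
Qed.

(** * Integration by parts as an inequality *)

(** The endpoints form a null set, where any values keep [k] measurable. *)
Lemma integrable_itvoo_itvcc (R : realType) (c d : R) (k : R -> R) :
  lebesgue_measure.-integrable `]c, d[ (EFin \o k) ->
  lebesgue_measure.-integrable `[c, d] (EFin \o k).
Proof.
move=> /integrableP[mk intk].
have mcc : measurable_fun `[c, d] (EFin \o k).
  exact: emeasurable_fun_itv_cc mk.
apply/integrableP; split=> //.
rewrite integral_itv_bndoo//.
by apply: measurableT_comp => //; exact: mk.
Qed.

Lemma integrable_ge0_derivative_itv (R : realType) (c d : R) (K k : R -> R) :
  c < d -> {within `[c, d], continuous K} ->
  {in `]c, d[, forall x, is_derive x (1 : R) K (k x)} ->
  {in `]c, d[, continuous k} ->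
  {in `]c, d[, forall x, 0 <= k x} ->
  lebesgue_measure.-integrable `[c, d] (EFin \o k).
Proof.
move=> cd cK dK ck k0; apply: integrable_itvoo_itvcc.
have dK1 x : x \in `]c, d[ -> derivable K x 1 by move=> /dK[].
have Kndecr : forall x y, c <= x -> x <= y -> y <= d -> K x <= K y.
  apply: ger0_derive1_ndecr => //.
  by move=> x xcd; rewrite derive1E; have [_ ->] := dK x xcd; exact: k0.
apply: (@integrable_ge0_derivative _ K k _ (fun n => c + n.+1%:R^-1)
  (fun n => d - n.+1%:R^-1) (K d - K c)).
- by move=> m n mn; rewrite lerD2l lef_pV2 ?posrE ?ltr0n// ler_nat.
- by move=> m n mn; rewrite lerD2l lerN2 lef_pV2 ?posrE ?ltr0n// ler_nat.
- exact: itvoo_bigcup.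
- by move=> x; exact: dK.
- by move=> x; exact: ck.
- by move=> x; exact: k0.
- by rewrite subr_ge0 Kndecr// ltW.
- move=> n; have : 0 < n.+1%:R^-1 :> R by rewrite invr_gt0 ltr0n.
  move: (n.+1%:R^-1) => e e0 uv.
  by apply: lerB; apply: Kndecr; lra.
Qed.

(** A mean value inequality whose majorant varies with the point: [Phi - G] and
[Phi + G] both have a nonnegative derivative, so no integral of [g] appears. *)
Lemma norm_increment_le (R : realType) (c d : R) (G g Phi phi : R -> R) :
  c < d ->
  {within `[c, d], continuous G} ->
  {in `]c, d[, forall x, is_derive x (1 : R) G (g x)} ->
  {within `[c, d], continuous Phi} ->
  {in `]c, d[, forall x, is_derive x (1 : R) Phi (phi x)} ->
  {in `]c, d[, forall x, `|g x| <= phi x} ->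
  `|G d - G c| <= Phi d - Phi c.
Proof.
move=> cd cG dG cPhi dPhi gphi.
have incr (s : R) : `|s| = 1 -> s * (G d - G c) <= Phi d - Phi c.
  move=> s1; pose H x := Phi x - s * G x.
  have cH : {within `[c, d], continuous H}.
    by move=> x; apply: cvgB; [exact: cPhi|apply: cvgMl_tmp; exact: cG].
  have dH x : x \in `]c, d[ -> is_derive x 1 H (phi x - s * g x).
    by move=> xcd; exact: is_deriveB (dPhi _ xcd) (is_deriveZ s (dG _ xcd)).
  have dH0 x : x \in `]c, d[ -> 0 <= H^`()%classic x.
    move=> xcd; rewrite derive1E; have [_ ->] := dH x xcd; rewrite subr_ge0.
    by rewrite (le_trans (ler_norm _))// normrM s1 mul1r gphi.
  have dH1 x : x \in `]c, d[ -> derivable H x 1 by move=> /dH[].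
  have := ger0_derive1_ndecr dH1 dH0 cH (lexx c) (ltW cd) (lexx d).
  by rewrite /H; lra.
rewrite ler_norml.
have := incr 1 (normr1 _); have := incr (-1); rewrite normrN1 => /(_ erefl).
by move=> ? ?; apply/andP; split; lra.
Qed.

(** Let [G x] be [K x * f x] minus the integral of [f k] over [[c, x]].  In its
derivative the two terms [k x * f x] cancel, leaving [K x * df x]. *)
Lemma by_parts_bound (R : realType) (c d : R) (K k f df Phi phi : R -> R) :
  c < d ->
  {within `[c, d], continuous K} ->
  {in `]c, d[, forall x, is_derive x (1 : R) K (k x)} ->
  {in `]c, d[, continuous k} ->
  {in `]c, d[, forall x, 0 <= k x} ->
  {within `[c, d], continuous f} ->
  {in `]c, d[, forall x, is_derive x (1 : R) f (df x)} ->
  {within `[c, d], continuous Phi} ->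
  {in `]c, d[, forall x, is_derive x (1 : R) Phi (phi x)} ->
  {in `]c, d[, forall x, `|K x * df x| <= phi x} ->
  `| K d * f d - K c * f c - \int[lebesgue_measure]_(y in `[c, d]) (f y * k y) |
    <= Phi d - Phi c.
Proof.
move=> cd cK dK ck k0 cf dF cPhi dPhi Kdf.
have intk := integrable_ge0_derivative_itv cd cK dK ck k0.
have intfk : lebesgue_measure.-integrable `[c, d] (EFin \o (fun y => f y * k y)).
  apply: integrableMr intk => //.
    exact: subspace_continuous_measurable_fun.
  have /compact_bounded[M [_ fM]] := continuous_compact cf (@segment_compact _ c d).
  by exists M; split; rewrite ?num_real // => ? ? ? ?; exact: fM.
pose P x := parameterized_integral lebesgue_measure c x (fun y => f y * k y).
have cP : {within `[c, d], continuous P}.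
  exact: parameterized_integral_continuous (ltW cd) intfk.
have cf_in : {in `]c, d[, continuous f}.
  by move=> x /dF; exact: is_derive_continuous.
have dP x : x \in `]c, d[ -> is_derive x 1 P (f x * k x).
  move=> xcd; have /andP[cx xd] : c < x < d by rewrite in_itv/= in xcd.
  have cfk : {for x, continuous (fun y => f y * k y)}.
    exact: cvgM (cf_in _ xcd) (ck _ xcd).
  have [dP1 dP2] : derivable P x 1 /\ P^`()%classic x = f x * k x.
    exact: continuous_FTC1_closed xd intfk cx cfk.
  by split; [exact: dP1|rewrite -derive1E; exact: dP2].
pose G x := K x * f x - P x.
have dG x : x \in `]c, d[ -> is_derive x 1 G (K x * df x).
  move=> xcd; have := is_deriveB (is_deriveM (dK _ xcd) (dF _ xcd)) (dP _ xcd).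
  by rewrite /GRing.scale/= addrK.
have cG : {within `[c, d], continuous G}.
  move=> x; apply: cvgB; last exact: cP.
  by apply: cvgM; [exact: cK|exact: cf].
have PE : P c = 0 by rewrite /P /parameterized_integral set_itv1 Rintegral_set1.
have -> : K d * f d - K c * f c - \int[lebesgue_measure]_(y in `[c, d]) (f y * k y)
    = G d - G c by rewrite /G PE subr0 addrAC.
exact: (@norm_increment_le _ _ _ G (fun x => K x * df x) Phi phi).
Qed.

(** * Power kernels *)

(** The absolute value avoids the jump of [powR] at base 0: negative bases have
power 1 by convention. *)
Lemma continuous_norm_powR (R : realType) (r : R) : 0 < r ->
  continuous (fun x : R => `|x| `^ r).
Proof.
move=> r0 x; have [->|x0] := eqVneq x 0; last first.
  apply: (@continuous_comp _ _ _ (fun x : R => `|x|) (fun y => y `^ r)).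
    exact: norm_continuous.
  have x_gt0 : 0 < `|x| by rewrite normr_gt0.
  exact: is_derive_continuous (is_derive1_powR r x_gt0).
apply/cvgrPdist_lt => e e0; near=> y.
rewrite normr0 powR0 ?gt_eqF// sub0r normrN ger0_norm ?powR_ge0//.
(* it suffices that |y| < e^(1/r) *)
have -> : e = (e `^ r^-1) `^ r by rewrite -powRrM mulVf ?gt_eqF// powRr1// ltW.
rewrite gt0_ltr_powR// ?nnegrE ?powR_ge0//.
near: y; apply/nbhs_normP; exists (e `^ r^-1); first by rewrite /= powR_gt0.
by move=> y /=; rewrite sub0r normrN.
Unshelve. all: by end_near. Qed.

(** The kernels singular at the left and at the right end of [[c, d]] are treated
together as powers of [e * (y - z)], with [(e, z)] equal to [(1, c)] or [(-1, d)].
Young's inequality is applied to (u/h)^r and |f'|, where u = e (y - z), and [X] is a primitive of the majorant [omega] of |f'|^q. *)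
Lemma power_kernel_bound (R : realType) (c d e z h r p q : R)
    (f df X omega : R -> R) :
  c < d -> e * e = 1 -> 0 < h ->
  {in `[c, d], forall y, 0 <= e * (y - z)} ->
  {in `]c, d[, forall y, 0 < e * (y - z)} ->
  0 < r -> 0 < p -> 0 < q -> p^-1 + q^-1 = 1 ->
  {within `[c, d], continuous f} ->
  {in `]c, d[, forall x, is_derive x (1 : R) f (df x)} ->
  (forall x, is_derive x (1 : R) X (omega x)) ->
  {in `]c, d[, forall x, `|df x| `^ q <= omega x} ->
  `| e * (e * (d - z)) `^ r * f d - e * (e * (c - z)) `^ r * f c
     - r * \int[lebesgue_measure]_(y in `[c, d]) (f y * (e * (y - z)) `^ (r - 1)) |
  <= h `^ r *
     (e * h * ((e * (d - z) / h) `^ (r * p + 1) - (e * (c - z) / h) `^ (r * p + 1))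
        / (p * (r * p + 1))
      + (X d - X c) / q).
Proof.
move=> cd ee h0 u_ge0 u_gt0 r0 p0 q0 pq cf dF dX df_omega.
have rp1 : 0 < r * p + 1 by rewrite addr_gt0// mulr_gt0.
pose u y := e * (y - z).
have du (y : R) : is_derive y 1 u e.
  have := is_deriveZ e (is_deriveB (is_derive_id y 1) (is_derive_cst z y 1)).
  by rewrite subr0 /GRing.scale/= mulr1.
have cu : continuous u by move=> y; exact: is_derive_continuous (du y).
have dpow (a : R) (y : R) : y \in `]c, d[ ->
    is_derive y 1 (fun y => u y `^ a) (a * u y `^ (a - 1) * e).
  move=> ycd; have uy : 0 < u y := u_gt0 y ycd.
  exact: (is_derive_chain (is_derive1_powR a uy) (du y)).
have cpow (a : R) : 0 < a -> {within `[c, d], continuous (fun y => u y `^ a)}.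
  move=> a0.
  apply: (@subspace_eq_continuous _ _ _ (fun y => `|u y| `^ a)).
    by move=> y /set_mem ycd; rewrite /= ger0_norm ?u_ge0.
  apply: continuous_subspaceT => y.
  exact: (continuous_comp (cu y) (continuous_norm_powR a0 (x := u y))).
(* K is the primitive of k with value 0 at z; Phi is a primitive of phi. *)
pose K y := r^-1 * (e * u y `^ r).
pose k y := u y `^ (r - 1).
pose beta := r * p.
(* (u / h)^a is kept as w a * u^a, where the second factor has a known
   derivative; the two agree only for nonnegative u. *)
pose w a : R := h^-1 `^ a.
have wS : h * w (beta + 1) = w beta.
  rewrite /w powRD; last by rewrite invr_eq0 (gt_eqF h0) implybT.
  by rewrite powRr1 ?invr_ge0 ?ltW// mulrCA mulfV ?gt_eqF// mulr1.
pose Phi y := r^-1 * (h `^ r *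
  (e * h / (p * (beta + 1)) * w (beta + 1) * u y `^ (beta + 1) + q^-1 * X y)).
pose phi y := r^-1 * (h `^ r * (p^-1 * (w beta * u y `^ beta) + q^-1 * omega y)).
have bound : `| K d * f d - K c * f c
      - \int[lebesgue_measure]_(y in `[c, d]) (f y * k y) | <= Phi d - Phi c.
  apply: (@by_parts_bound _ c d K k f df Phi phi cd _ _ _ _ cf dF).
  - by move=> y; apply: cvgMl_tmp; apply: cvgMl_tmp; exact: cpow.
  - move=> y ycd; have := is_deriveZ r^-1 (is_deriveZ e (dpow r y ycd)).
    rewrite /GRing.scale/= (mulrC _ e) !mulrA -(mulrA _ e e) ee mulr1.
    by rewrite mulVf ?gt_eqF// mul1r.
  - by move=> y ycd; exact: is_derive_continuous (dpow (r - 1) y ycd).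
  - by move=> y ycd; exact: powR_ge0.
  - have cX : {within `[c, d], continuous X}.
      by apply: continuous_subspaceT => y; exact: is_derive_continuous (dX y).
    move=> y; apply: cvgMl_tmp; apply: cvgMl_tmp; apply: cvgD.
      by apply: cvgMl_tmp; exact: cpow.
    by apply: cvgMl_tmp; exact: cX.
  - move=> y ycd.
    have -> : phi y = r^-1 *: (h `^ r *: (
        (e * h / (p * (beta + 1)) * w (beta + 1))
          *: ((beta + 1) * u y `^ (beta + 1 - 1) * e) + q^-1 *: omega y)).
      rewrite /phi addrK -wS /GRing.scale/=; congr (_ * (_ * (_ + _))).
      move: (w _) (u y `^ beta) => W U.
      transitivity ((e * e) * (p^-1 * (h * W * U))); first by rewrite ee mul1r.
      by field; rewrite !gt_eqF.
    exact: is_deriveZ _ (is_deriveZ _ (is_deriveD (is_deriveZ _ (dpow _ y ycd))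
      (is_deriveZ _ (dX y)))).
  - move=> y ycd; have uy : 0 < u y := u_gt0 y ycd.
    have e1 : `|e| = 1.
      by apply/eqP; rewrite -(@eqrXn2 _ 2)// expr1n -normrX expr2 ee normr1.
    rewrite /K /phi !normrM e1 mul1r (ger0_norm (powR_ge0 _ _)).
    rewrite (@ger0_norm _ r^-1) ?invr_ge0 ?(ltW r0)// -mulrA.
    rewrite ler_wpM2l ?invr_ge0 ?(ltW r0)//.
    (* scaling by h makes the Young bound homogeneous *)
    have -> : u y `^ r = h `^ r * (h^-1 * u y) `^ r.
      rewrite -powRM ?ltW//; last by rewrite mulr_gt0// invr_gt0.
      by rewrite mulrA mulfV ?gt_eqF// mul1r.
    rewrite -mulrA ler_wpM2l ?powR_ge0//.
    apply: (le_trans (conjugate_powR (powR_ge0 _ _) (normr_ge0 _) p0 q0 pq)).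
    rewrite -powRrM powRM ?invr_ge0 ?(ltW h0) ?(ltW uy)// mulrC lerD2l mulrC.
    by rewrite ler_wpM2l ?invr_ge0 ?(ltW q0)// df_omega.
have r_neq0 : r != 0 by rewrite gt_eqF.
rewrite [leLHS](_ : _ = r * `| K d * f d - K c * f c
      - \int[lebesgue_measure]_(y in `[c, d]) (f y * k y) |); last first.
  rewrite -[in RHS](gtr0_norm r0) -normrM; congr `|_|.
  rewrite /K /u /k; move: (\int[_]_(_ in _) _) => I.
  by field.
rewrite [leRHS](_ : _ = r * (Phi d - Phi c)).
  by rewrite ler_wpM2l// (ltW r0).
have split_pow y : y \in `[c, d] ->
    (e * (y - z) / h) `^ (beta + 1) = w (beta + 1) * u y `^ (beta + 1).
  by move=> ycd; rewrite mulrC powRM ?invr_ge0 ?(ltW h0) ?u_ge0.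
rewrite -/beta !split_pow ?in_itv/= ?lexx ?(ltW cd)// /Phi.
move: (w _) (u c `^ _) (u d `^ _) (h `^ r) (X c) (X d) => W Uc Ud H Xc Xd.
by field; rewrite !gt_eqF.
Qed.

Lemma left_power_kernel_bound (R : realType) (c d r p q : R)
    (f df X omega : R -> R) :
  c < d -> 0 < r -> 0 < p -> 0 < q -> p^-1 + q^-1 = 1 ->
  {within `[c, d], continuous f} ->
  {in `]c, d[, forall x, is_derive x (1 : R) f (df x)} ->
  (forall x, is_derive x (1 : R) X (omega x)) ->
  {in `]c, d[, forall x, `|df x| `^ q <= omega x} ->
  `| (d - c) `^ r * f d
     - r * \int[lebesgue_measure]_(y in `[c, d]) (f y * (y - c) `^ (r - 1)) |
  <= (d - c) `^ r * ((d - c) / (p * (r * p + 1)) + (X d - X c) / q).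
Proof.
move=> cd r0 p0 q0 pq cf dF dX df_omega.
have h0 : 0 < d - c by rewrite subr_gt0.
have rp1 : r * p + 1 != 0 by rewrite gt_eqF// addr_gt0// mulr_gt0.
have := @power_kernel_bound _ c d 1 c (d - c) r p q f df X omega cd (mulr1 1) h0
  _ _ r0 p0 q0 pq cf dF dX df_omega.
rewrite !mul1r subrr mul0r powR0 ?gt_eqF// mul0r subr0 powR0//.
rewrite mulfV ?gt_eqF// powR1 subr0 mulr1.
under eq_Rintegral do rewrite mul1r.
by apply=> y; rewrite in_itv/= => /andP[cy yd]; rewrite mul1r ?subr_gt0 ?subr_ge0.
Qed.

Lemma right_power_kernel_bound (R : realType) (c d r p q : R)
    (f df X omega : R -> R) :
  c < d -> 0 < r -> 0 < p -> 0 < q -> p^-1 + q^-1 = 1 ->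
  {within `[c, d], continuous f} ->
  {in `]c, d[, forall x, is_derive x (1 : R) f (df x)} ->
  (forall x, is_derive x (1 : R) X (omega x)) ->
  {in `]c, d[, forall x, `|df x| `^ q <= omega x} ->
  `| (d - c) `^ r * f c
     - r * \int[lebesgue_measure]_(y in `[c, d]) (f y * (d - y) `^ (r - 1)) |
  <= (d - c) `^ r * ((d - c) / (p * (r * p + 1)) + (X d - X c) / q).
Proof.
move=> cd r0 p0 q0 pq cf dF dX df_omega.
have h0 : 0 < d - c by rewrite subr_gt0.
have rp1 : r * p + 1 != 0 by rewrite gt_eqF// addr_gt0// mulr_gt0.
have ee : (-1) * (-1) = 1 :> R by rewrite mulrNN mulr1.
have := @power_kernel_bound _ c d (-1) d (d - c) r p q f df X omega cd ee h0
  _ _ r0 p0 q0 pq cf dF dX df_omega.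
rewrite subrr mulr0 powR0 ?gt_eqF// mulr0 mul0r sub0r.
rewrite !mulN1r opprB mulNr opprK mul0r powR0// sub0r.
rewrite mulfV ?gt_eqF// powR1 mulNr mulrN opprK mulr1.
under eq_Rintegral do rewrite mulN1r opprB.
apply=> y; rewrite in_itv/= => /andP[cy yd];
  by rewrite mulN1r opprB ?subr_gt0 ?subr_ge0.
Qed.

(** * One-sided derivatives, convexity and the main inequality *)

(** [f y] is [f x] plus the difference quotient times [y - x]. *)
Lemma is_right_derivative_cvg (R : realType) (f : R -> R) (x l : R) :
  is_right_derivative f x l -> f y @[y --> x^'+] --> f x.
Proof.
move=> fl; have id0 : (y - x) @[y --> x^'+] --> 0.
  apply: cvg_at_right_filter; rewrite -(subrr x).
  by apply: cvgB; [exact: cvg_id|exact: cvg_cst].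
have : (f x + (f y - f x) / (y - x) * (y - x)) @[y --> x^'+] --> f x + l * 0.
  by apply: cvgD; [exact: cvg_cst|exact: cvgM fl id0].
rewrite mulr0 addr0; apply: cvg_trans; apply: near_eq_cvg; near=> y.
have xy : x < y by near: y; exact: nbhs_right_gt.
by rewrite divfK ?subrKC// gt_eqF// subr_gt0.
Unshelve. all: by end_near. Qed.

Lemma is_left_derivative_cvg (R : realType) (f : R -> R) (x l : R) :
  is_left_derivative f x l -> f y @[y --> x^'-] --> f x.
Proof.
move=> fl; have id0 : (y - x) @[y --> x^'-] --> 0.
  apply: cvg_at_left_filter; rewrite -(subrr x).
  by apply: cvgB; [exact: cvg_id|exact: cvg_cst].
have : (f x + (f y - f x) / (y - x) * (y - x)) @[y --> x^'-] --> f x + l * 0.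
  by apply: cvgD; [exact: cvg_cst|exact: cvgM fl id0].
rewrite mulr0 addr0; apply: cvg_trans; apply: near_eq_cvg; near=> y.
have xy : y < x by near: y; exact: nbhs_left_lt.
by rewrite divfK ?subrKC// lt_eqF// subr_lt0.
Unshelve. all: by end_near. Qed.

Lemma is_derivative_on_continuous (R : realType) (a b : R) (f df : R -> R) :
  a < b -> is_derivative_on a b f df -> {within `[a, b], continuous f}.
Proof.
move=> ab [dF dFa dFb]; apply/continuous_within_itvP => //; split.
- by move=> x /dF; exact: is_derive_continuous.
- exact: is_right_derivative_cvg dFa.
- exact: is_left_derivative_cvg dFb.
Qed.

Lemma convex_le_chord (R : realType) (a b : R) (g : R -> R) : a < b ->
  convex_function (`[a, b]%classic : set R^o) g ->
  {in `[a, b], forall y,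
    g y <= (g a * (b - y) + g b * (y - a)) / (b - a)}.
Proof.
move=> ab gconv y; rewrite in_itv/= => /andP[ay yb].
have ba0 : 0 < b - a by rewrite subr_gt0.
have t0 : 0 <= (b - y) / (b - a) by rewrite divr_ge0 ?subr_ge0// ltW.
have t1 : (b - y) / (b - a) <= 1 by rewrite ler_pdivrMr// mul1r lerD2l lerN2.
have memab (x : R) : a <= x -> x <= b -> x \in (`[a, b]%classic : set R).
  by move=> ax xb; apply: mem_set; rewrite /= in_itv/= ax xb.
have := gconv (Itv01 t0 t1) a b (memab _ (lexx a) (ltW ab))
  (memab _ (ltW ab) (lexx b)).
have ba : b - a != 0 by rewrite gt_eqF.
move=> gab; apply: le_trans (le_trans _ gab) _;
  rewrite le_eqVlt; apply/orP; left; apply/eqP.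
  congr g; transitivity ((b - y) / (b - a) * a + (1 - (b - y) / (b - a)) * b).
    by field.
  by [].
transitivity ((b - y) / (b - a) * g a + (1 - (b - y) / (b - a)) * g b).
  by [].
by field.
Qed.

Theorem theorem2p4 (R : realType) (theta1 theta2 : R) (f df B : R -> R)
    (alpha p q : R)
    (htheta : theta1 < theta2)
    (hdf : is_derivative_on theta1 theta2 f df)
    (hL1 : lebesgue_measure.-integrable `[theta1, theta2] (EFin \o df))
    (hconv : convex_function (`[theta1, theta2]%classic : set R^o)
               (fun x : R => `|df x| `^ q))
    (hpq : p^-1 + q^-1 = 1) (hq : 1 < q)
    (halpha : 0 < alpha <= 1)
    (hB : B alpha != 0) :
  let m := (theta1 + theta2) / 2 in
  `| (2 * (theta2 - theta1) `^ alpha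
      + (1 - alpha) * 2 `^ (alpha + 1) * Gamma_fun alpha)
       / (theta2 - theta1) `^ (alpha + 1)
       * (f theta1 + f theta2 + 2 * f m)
     - 2 `^ (alpha + 1) * B alpha * Gamma_fun alpha
       / (theta2 - theta1) `^ (alpha + 1)
       * (AB_right B m alpha f theta1 + AB_left B theta1 alpha f m
          + AB_left B m alpha f theta2 + AB_right B theta2 alpha f m) |
  <= 4 / (p * (alpha * p + 1))
     + 2 * (`|df theta1| `^ q + `|df theta2| `^ q) / q.
Proof.
cbv zeta; set m := (theta1 + theta2) / 2.
set a := theta1 in htheta hdf hL1 hconv m *.
set b := theta2 in htheta hdf hL1 hconv m *.
have G0 := Gamma_fun_gt0 halpha.
have /andP[alpha0 alpha1] := halpha.
have q0 : 0 < q := lt_trans ltr01 hq.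
have p0 : 0 < p.
  rewrite -invr_gt0 (_ : p^-1 = 1 - q^-1); last by rewrite -hpq addrK.
  by rewrite subr_gt0 invf_lt1.
have ap1 : 0 < alpha * p + 1 by rewrite addr_gt0// mulr_gt0.
pose h := (b - a) / 2.
have h0 : 0 < h by rewrite divr_gt0// subr_gt0.
have ma : m - a = h by rewrite /m /h; field.
have bm : b - m = h by rewrite /m /h; field.
have am : a < m by rewrite -subr_gt0 ma.
have mb : m < b by rewrite -subr_gt0 bm.
have cf := is_derivative_on_continuous htheta hdf.
have [dF _ _] := hdf.
set A := `|df a| `^ q; set C := `|df b| `^ q.
(* omega is the chord of |f'|^q over [a, b], and X is a primitive of it. *)
pose omega y := (A * (b - y) + C * (y - a)) / (b - a).
pose X y := (2 * (b - a))^-1 *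
  (C * ((y - a) * (y - a)) - A * ((b - y) * (b - y))).
have ba0 : b - a != 0 by rewrite subr_eq0 gt_eqF.
have dX (y : R) : is_derive y 1 X (omega y).
  have d1 := is_deriveB (is_derive_id y 1) (is_derive_cst a y 1).
  have d2 := is_deriveB (is_derive_cst b y 1) (is_derive_id y 1).
  have D := is_deriveZ (2 * (b - a))^-1 (is_deriveB
    (is_deriveZ C (is_deriveM d1 d1)) (is_deriveZ A (is_deriveM d2 d2))).
  apply: (is_derive_eq (f := X) D).
  by rewrite /omega /GRing.scale/= /cst !fctE; field.
have sub1 : {subset `]a, m[ <= `]a, b[}.
  by apply: subset_itvl; rewrite bnd_simp ltW.
have sub2 : {subset `]m, b[ <= `]a, b[}.
  by apply: subset_itvr; rewrite bnd_simp ltW.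
have df_omega : {in `]a, b[, forall y, `|df y| `^ q <= omega y}.
  by move=> y /subset_itv_oo_cc yab; exact: (convex_le_chord htheta hconv yab).
have cf1 : {within `[a, m], continuous f}.
  by apply: continuous_subspaceW cf; apply: subset_itvl; rewrite bnd_simp ltW.
have cf2 : {within `[m, b], continuous f}.
  by apply: continuous_subspaceW cf; apply: subset_itvr; rewrite bnd_simp ltW.
have dF1 : {in `]a, m[, forall x, is_derive x (1 : R) f (df x)}.
  by move=> x /sub1; exact: dF.
have dF2 : {in `]m, b[, forall x, is_derive x (1 : R) f (df x)}.
  by move=> x /sub2; exact: dF.
have dfo1 : {in `]a, m[, forall y, `|df y| `^ q <= omega y}.
  by move=> x /sub1; exact: df_omega.
have dfo2 : {in `]m, b[, forall y, `|df y| `^ q <= omega y}.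
  by move=> x /sub2; exact: df_omega.
have := left_power_kernel_bound am alpha0 p0 q0 hpq cf1 dF1 dX dfo1.
have := right_power_kernel_bound am alpha0 p0 q0 hpq cf1 dF1 dX dfo1.
have := right_power_kernel_bound mb alpha0 p0 q0 hpq cf2 dF2 dX dfo2.
have := left_power_kernel_bound mb alpha0 p0 q0 hpq cf2 dF2 dX dfo2.
rewrite /AB_left /AB_right ma bm.
set I1 := (\int[lebesgue_measure]_(y in `[a, m]) (f y * (y - a) `^ (alpha - 1)))%R.
set I2 := (\int[lebesgue_measure]_(y in `[a, m]) (f y * (m - y) `^ (alpha - 1)))%R.
set I3 := (\int[lebesgue_measure]_(y in `[m, b]) (f y * (b - y) `^ (alpha - 1)))%R.
set I4 := (\int[lebesgue_measure]_(y in `[m, b]) (f y * (y - m) `^ (alpha - 1)))%R.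
move=> H4 H3 H2 H1.
have bah : b - a = 2 * h by rewrite /h; field.
(* otherwise powRM would also split h^alpha, h being the product (b - a) / 2 *)
clearbody h I1 I2 I3 I4.
rewrite bah !powRM ?(ltW h0)//.
rewrite [2 `^ (alpha + 1)]powRD ?pnatr_eq0 ?implybT// powRr1//.
rewrite [h `^ (alpha + 1)]powRD ?(gt_eqF h0) ?implybT// powRr1 ?(ltW h0)//.
have U0 : 0 < h `^ alpha by rewrite powR_gt0.
have T0 : 0 < 2 `^ alpha :> R by rewrite powR_gt0.
set U := h `^ alpha in H1 H2 H3 H4 U0 *; set T := 2 `^ alpha in T0 *.
set G := Gamma_fun alpha in G0 *.
have XE : X b - X a = h * (A + C).
  by rewrite /X !subrr bah; field; rewrite gt_eqF.
(* the four differences; Gamma(alpha) and B(alpha) cancel in their sum *)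
set D1 := U * f m - _ in H1; set D2 := U * f a - _ in H2.
set D3 := U * f m - _ in H3; set D4 := U * f b - _ in H4.
rewrite [X in `|X|](_ : _ = (D1 + D2 + D3 + D4) / (U * h)); last first.
  by rewrite /D1 /D2 /D3 /D4; field; rewrite hB !gt_eqF.
rewrite normrM (@gtr0_norm _ (U * h)^-1) ?invr_gt0 ?mulr_gt0//.
rewrite ler_pdivrMr ?mulr_gt0//.
apply: (@le_trans _ _ (`|D1| + `|D2| + `|D3| + `|D4|)).
  apply: (le_trans (ler_normD _ _)); rewrite lerD2r.
  apply: (le_trans (ler_normD _ _)); rewrite lerD2r.
  exact: ler_normD.
apply: (le_trans (lerD (lerD (lerD H1 H2) H3) H4)).
rewrite le_eqVlt; apply/orP; left; apply/eqP.
transitivity (U * (4 * h / (p * (alpha * p + 1)) + 2 * (X b - X a) / q)).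
  by field; rewrite !gt_eqF.
by rewrite XE; field; rewrite !gt_eqF.
Qed.
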